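(* Let $G$ and $G'$ be graphs and $k\ge2$. Suppose that (a1) $\Delta G\ge k$ and $G\in\mathcal{G}_{\bowtie}$, (a2) $\Delta(G\setminus x)\ge k$ and $G\setminus x\in\mathcal{G}_{\bowtie}$ for every vertex $x$ in $G$, and (a3) $M_k(G')=M_k(G)$. Then $\mathcal{S}(G)=\mathcal{S}(G')$, i.e. $G$ and $G'$ are strongly isomorphic.
   Context: Graphs are finite and may have loops and parallel edges. For $X\subseteq E(G)$, $G\langle X\rangle$ is the subgraph of $G$ induced by $X$, i.e. with edge set $X$ and whose vertices are the end-vertices of edges in $X$. $\Delta G=|E(G)|-|V(G)|$. $\mathcal{G}_{\bowtie}$ is the set of graphs having no isolated vertices, no leaves (vertices of degree 1, a loop contributing 2 to the degree), and no cycle components (components that are cycles; a vertex with a single loop is a cycle, and two parallel edges form a cycle). For $k\ge1$ the $k$-circular matroid $M_k(G)$ is the matroid on $E(G)$ whose circuits are the sets $C\subseteq E(G)$ with $\Delta G\langle C\rangle=k$ and $G\langle C\rangle\in\mathcal{G}_{\bowtie}$ (these are known to be the circuits of a matroid). Equality $M_k(G)=M_k(G')$ means equality of ground sets $E(G)=E(G')$ and of the families of circuits. $G\setminus x$ is $G$ with vertex $x$ and all edges incident to it deleted. $S(x,G)$ is the set of edges of $G$ incident to $x$ (loops included), and $\mathcal{S}(G)=\{S(x,G):x\in V(G)\}$. Graphs $G=(V,E,\phi)$ and $G'=(V',E,\phi')$ with the same edge set are strongly isomorphic if there is a bijection $\nu:V\to V'$ such that for each edge $e$: $\phi(e)=\{x,y\}\Leftrightarrow\phi'(e)=\{\nu(x),\nu(y)\}$,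 where $\phi(e)$ is the set of end-vertices of $e$.
   Formalization: The formal theorem additionally assumes that G' has no isolated vertices; without this the claim fails, e.g. G = K_5, k = 2, G' = K_5 plus an isolated vertex, which has the same k-circular matroid. *)

(* Defs.v *)
From mathcomp Require Import all_boot all_order all_algebra.
Set Implicit Arguments.
Unset Strict Implicit.
Unset Printing Implicit Defensive.
Import Order.TTheory GRing.Theory Num.Theory.

(* Finite graphs with loops and parallel edges; vertices and edges are subsets
   of ambient finite types, so that subgraphs of a graph share its types. An
   edge with one end-vertex is a loop. The values of [ends] outside [edges] are
   meaningless. *)
Record graph (V E : finType) := Graph {
  verts : {set V};
  edges : {set E};
  ends : E -> {set V};
  ends_verts : forall e, e \in edges -> ends e \subset verts;
  ends_card : forall e, e \in edges -> 0 < #|ends e| <= 2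
}.

Section Subgraph.
Variables (V E : finType) (G : graph V E) (W : {set V}) (F : {set E}).

Let sub_verts := verts G :&: W.
Let sub_edges := [set e in edges G :&: F | ends G e \subset W].

Fact subgraph_ends_verts e : e \in sub_edges -> ends G e \subset sub_verts.
Proof.
by rewrite !inE subsetI => /andP[/andP[eG _] ->]; rewrite ends_verts.
Qed.

Fact subgraph_ends_card e : e \in sub_edges -> 0 < #|ends G e| <= 2.
Proof. by rewrite !inE => /andP[/andP[eG _] _]; exact: ends_card. Qed.

(* The vertices of G in W, and the edges of G in F with all ends in W. *)
Definition subgraph := Graph subgraph_ends_verts subgraph_ends_card.

End Subgraph.

Section GraphNotions.
Variables V E : finType.
Implicit Types (G : graph V E) (x y : V) (X C : {set E}).

(* G<X>, for X a subset of [edges G] *)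
Definition edge_induced G X : graph V E :=
  subgraph G (\bigcup_(e in X) ends G e) X.

(* G \ x *)
Definition del_vertex G x : graph V E := subgraph G [set~ x] [set: E].

(* Integer-valued: it is negative for instance for trees. *)
Definition Delta G : int := (#|edges G|%:Z - #|verts G|%:Z)%R.

Definition star G x : {set E} := [set e in edges G | x \in ends G e].

Definition stars G : {set {set E}} := [set star G x | x in verts G].

Definition degree G x : nat :=
  \sum_(e in star G x) (if #|ends G e| == 1 then 2 else 1).

Definition isolated G x : bool := degree G x == 0.

Definition leaf G x : bool := degree G x == 1.

Definition adjacent G : rel V :=
  [rel x y | [exists e in edges G, ends G e == [set x; y]]].

Definition connected G : bool :=
  (verts G != set0) &&
  [forall x in verts G, forall y in verts G, connect (adjacent G) x y].

(* As a loop counts twice in the degree, this includes a vertex with a single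
   loop, and two vertices joined by two parallel edges. *)
Definition is_cycle G : bool :=
  connected G && [forall x in verts G, degree G x == 2].

(* The component of the vertex x of G. *)
Definition component G x : graph V E :=
  subgraph G [set y | connect (adjacent G) x y] [set: E].

Definition no_isolated G : bool := [forall x in verts G, ~~ isolated G x].

Definition bowtie G : bool :=
  [&& no_isolated G,
      [forall x in verts G, ~~ leaf G x]
    & [forall x in verts G, ~~ is_cycle (component G x)]].

Definition circuits (k : nat) G : {set {set E}} :=
  [set C : {set E} | [&& C \subset edges G,
                         Delta (edge_induced G C) == k%:Z%R
                       & bowtie (edge_induced G C)]].

(* The k-circular matroid, given by its ground set and its circuits. *)
Definition circular_matroid (k : nat) G : {set E} * {set {set E}} :=
  (edges G, circuits k G).

End GraphNotions.

Definition strongly_isomorphic (V V' E : finType)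
    (G : graph V E) (G' : graph V' E) : Prop :=
  edges G = edges G' /\
  exists nu : {x : V | x \in verts G} -> {x' : V' | x' \in verts G'},
    bijective nu /\
    forall e, e \in edges G -> forall x y : {x : V | x \in verts G},
      ends G e = [set val x; val y] <->
      ends G' e = [set val (nu x); val (nu y)].

(* Main.v *)
(* Call an edge set tight if every proper subset has a smaller excess
   |X| - |V(X)|. Among graphs without isolated vertices the bowtie graphs are
   those with tight edge set, so the circuits of M_k are the tight sets of
   excess k. As excess is supermodular, the tight sets of excess at least k are
   exactly the nonempty unions of circuits, and on these the circuits determine
   the excess (via chains of such sets). Hence M_k determines |V|, and E \ S(x),
   a union of circuits in G, is in G' a tight set spanning all vertices but one,
   x'. An edge outside E \ S(x) but not at x' would give a union of circuits
   with different excesses in G and G', so S(x) = S(x'). *)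
Require Import Defs.
From mathcomp Require Import all_boot all_order all_algebra.
From mathcomp Require Import zify.
Set Implicit Arguments.
Unset Strict Implicit.
Unset Printing Implicit Defensive.
Import Order.TTheory GRing.Theory Num.Theory.

(** * Excess, its supermodularity, and tight sets *)

Section Excess.
Variables V E : finType.
Implicit Types (G : graph V E) (X Y Z : {set E}).

Definition span G X : {set V} := \bigcup_(e in X) ends G e.

Definition excess G X : int := (#|X|%:Z - #|span G X|%:Z)%R.

Definition tight G X : Prop :=
  forall Z, Z \proper X -> (excess G Z < excess G X)%R.

Lemma spanS G X Y : X \subset Y -> span G X \subset span G Y.
Proof.
move=> sXY; apply/bigcupsP => e eX.
by apply: bigcup_sup; apply: (subsetP sXY).
Qed.

Lemma spanU G X Y : span G (X :|: Y) = span G X :|: span G Y.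
Proof. by rewrite /span bigcup_setU. Qed.

Lemma span_sub_verts G X : X \subset edges G -> span G X \subset verts G.
Proof. by move=> sX; apply/bigcupsP => e eX; rewrite ends_verts ?(subsetP sX). Qed.

Lemma excess0 G : excess G set0 = 0%R.
Proof. by rewrite /excess /span big_set0 !cards0. Qed.

Lemma excess_supermodular G X Y :
  (excess G X + excess G Y <= excess G (X :|: Y) + excess G (X :&: Y))%R.
Proof.
rewrite /excess spanU.
have := cardsUI X Y; have := cardsUI (span G X) (span G Y).
have : #|span G (X :&: Y)| <= #|span G X :&: span G Y|.
  by apply: subset_leq_card; rewrite subsetI !spanS ?subsetIl ?subsetIr.
lia.
Qed.

Lemma excess_delete G X e : (excess G X - 1 <= excess G (X :\ e))%R.
Proof.
rewrite /excess; have := cardsD1 e X.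
have := subset_leq_card (spanS G (subD1set X e)).
case: (e \in X) => /=; lia.
Qed.

Lemma tight_subset G X Z : tight G X -> Z \subset X ->
  (excess G Z <= excess G X)%R.
Proof.
by move=> tX; rewrite subEproper => /predU1P[->//|/tX/ltW].
Qed.

(** By supermodularity, adding a tight set [A] to any [Z] never lowers the excess, and raises it
    unless [A \subset Z]. If [Z] is proper in [X :|: Y], adding first [X] and then [Y] raises it at
    least once. *)
Lemma tightU G X Y : tight G X -> tight G Y -> tight G (X :|: Y).
Proof.
have absorb A Z : tight G A -> (excess G Z <= excess G (Z :|: A))%R /\
    (~~ (A \subset Z) -> (excess G Z < excess G (Z :|: A))%R).
  move=> tA; have := excess_supermodular G Z A.
  have := tight_subset tA (subsetIr Z A) => leA sup; split; first lia.
  move=> nAZ; suff /tA : Z :&: A \proper A by lia.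
  by rewrite properE subsetIr /= subsetI subxx andbT.
move=> tX tY Z /properP[sZ [e eXY neZ]].
have -> : X :|: Y = Z :|: X :|: Y.
  by rewrite -setUA; apply/esym/setUidPr.
have [le1 lt1] := absorb X Z tX; have [le2 lt2] := absorb Y (Z :|: X) tY.
have [sXZ|/lt1] := boolP (X \subset Z); last by lia.
suff /lt2 : ~~ (Y \subset Z :|: X) by lia.
apply/negP => sY; case/negP: neZ; case/setUP: eXY => [/(subsetP sXZ)//|].
by move/(subsetP sY); rewrite inE => /orP[//|/(subsetP sXZ)].
Qed.

(** An inclusion-minimal subset of excess at least [j] is tight. It is nonempty as [0 < j], and
    deleting an edge costs at most 1, so its excess is exactly [j]. *)
Lemma tight_subset_of_excess G X (j : int) : (0 < j)%R -> (j <= excess G X)%R ->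
  exists Y, [/\ Y \subset X, tight G Y & excess G Y = j].
Proof.
move=> j_gt0 leX.
have [Y /minsetP[leY minY] sYX] := @minset_exists _ (fun Y => j <= excess G Y)%R X leX.
exists Y; split=> //.
  move=> Z; rewrite properEneq => /andP[neZ sZ].
  rewrite ltNge; apply/negP => leZ; case/eqP: neZ; apply: minY => //.
  exact: le_trans leZ.
have [Y0|[e eY]] := set_0Vmem Y; first by move: leY; rewrite Y0 excess0; lia.
have := excess_delete G Y e.
suff : ~~ (j <= excess G (Y :\ e))%R by lia.
apply/negP => /minY /(_ (subD1set _ _)) eqY.
by have := setD11 e Y; rewrite eqY eY.
Qed.

(** This is the descent step towards a circuit through [a]. A tight [A] of the right excess is found
    avoiding [a], then a tight [B] avoiding some [f] of [A]; this [B] must contain [a]. *)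
Lemma tight_subset_at_edge G X a : tight G X -> (1 < excess G X)%R -> a \in X ->
  exists Y, [/\ Y \subset X, a \in Y, tight G Y
              & excess G Y = (excess G X - 1)%R].
Proof.
move=> tX X_gt1 aX; set j := (excess G X - 1)%R.
have j_gt0 : (0 < j)%R by rewrite /j; lia.
have [A [sA tA eA]] := tight_subset_of_excess j_gt0 (excess_delete G X a).
have [A0|[f fA]] := set_0Vmem A.
  by move: eA; rewrite A0 excess0 => eA; rewrite -eA in j_gt0.
have [B [sB tB eB]] := tight_subset_of_excess j_gt0 (excess_delete G X f).
exists B; split=> //; first exact: subset_trans sB (subD1set _ _).
(* otherwise the excess of A :|: B is at most that of A, so that A :&: B
   violates the tightness of A *)
apply/negPn/negP => naB.
have /tX ltU : A :|: B \proper X.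
  apply/properP; split; first by rewrite subUset (subset_trans sA) ?(subset_trans sB) ?subD1set.
  exists a => //; rewrite inE negb_or naB andbT.
  by apply/negP => /(subsetP sA); rewrite setD11.
have /tA ltI : A :&: B \proper A.
  apply/properP; split; first exact: subsetIl.
  exists f => //; rewrite inE fA /=.
  by apply/negP => /(subsetP sB); rewrite setD11.
have := excess_supermodular G A B; rewrite /j in eA eB; lia.
Qed.

End Excess.

(** * Degree counts, and bowtie graphs as graphs with tight edge set *)

Section Bowtie.
Variables V E : finType.
Implicit Types (G : graph V E) (X Y Z : {set E}).

Lemma spanE G : no_isolated G -> span G (edges G) = verts G.
Proof.
move=> niG; apply/eqP; rewrite eqEsubset span_sub_verts //=.
apply/subsetP => x xG; have := forall_inP niG x xG.
rewrite /isolated /degree; have [->|[e]] := set_0Vmem (star G x).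
  by rewrite big_set0.
by rewrite inE => /andP[eG xe] _; apply/bigcupP; exists e.
Qed.

Lemma sum_degree G (U : {set V}) :
  \sum_(u in U) degree G u =
  \sum_(e in edges G) (if #|ends G e| == 1 then 2 else 1) * #|U :&: ends G e|.
Proof.
rewrite (eq_bigr (fun u => \sum_(e in edges G | u \in ends G e)
    (if #|ends G e| == 1 then 2 else 1))); last first.
  by move=> u _; apply: eq_bigl => e; rewrite inE.
rewrite (exchange_big_dep (mem (edges G))) /=; last by move=> ? ? _ /andP[].
apply: eq_bigr => e eG.
rewrite (eq_bigl (mem (U :&: ends G e))); last by move=> u; rewrite /= !inE eG.
by rewrite sum_nat_const mulnC.
Qed.

(** The weight 2 of a loop makes up for its single end, so an edge with all ends in [U] contributes
    exactly 2. *)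
Lemma edge_weight G (U : {set V}) e : e \in edges G ->
  (if #|ends G e| == 1 then 2 else 1) * #|U :&: ends G e| <= 2
    ?= iff (ends G e \subset U).
Proof.
move=> eG; have := ends_card eG.
have := subset_leqif_cards (subsetIr U (ends G e)).
rewrite eqEsubset subsetIr subsetI subxx andbT /= => -[le eqc].
rewrite -eqc => e12; split; case: ifP => [/eqP|]; lia.
Qed.

Lemma handshake G : \sum_(u in verts G) degree G u = 2 * #|edges G|.
Proof.
rewrite sum_degree mulnC -sum_nat_const; apply: eq_bigr => e eG.
by apply/eqP; rewrite (edge_weight _ eG) ends_verts.
Qed.

Lemma adjacent_sym G : symmetric (adjacent G).
Proof. by move=> x y; apply: eq_existsb => e; rewrite setUC. Qed.

Lemma ends_pair G e x : e \in edges G -> x \in ends G e ->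
  exists y, ends G e = [set x; y].
Proof.
move=> eG xe; have := ends_card eG; rewrite (cardsD1 x) xe add1n !ltnS /=.
case: leqP => // c1 _; have [z0|[y ye]] := set_0Vmem (ends G e :\ x).
  by exists x; rewrite setUid -(setD1K xe) z0 setU0.
exists y; rewrite -(setD1K xe); congr (_ :|: _).
apply/esym/eqP; rewrite eqEcard sub1set ye cards1; lia.
Qed.

Lemma ends_component G x e y : e \in edges G -> y \in ends G e ->
  connect (adjacent G) x y -> ends G e \subset [set z | connect (adjacent G) x z].
Proof.
move=> eG ye xy; have [z ez] := ends_pair eG ye; rewrite ez subUset !sub1set !inE xy.
apply: connect_trans xy (connect1 _).
by apply/exists_inP; exists e => //; rewrite ez.
Qed.

Lemma degree_component G x y : connect (adjacent G) x y ->
  degree (component G x) y = degree G y.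
Proof.
move=> xy; apply: eq_bigl => e; rewrite !inE andbT.
apply: andb_id2r => ye; apply: andb_idr => eG.
exact: ends_component eG ye xy.
Qed.

Lemma connected_component G x : x \in verts G -> connected (component G x).
Proof.
move=> xG.
have xcomp y : connect (adjacent G) x y -> connect (adjacent (component G x)) x y.
  case/connectP => p; elim/last_ind: p y => [|p z IHp] y /= ; first by move=> _ ->.
  rewrite rcons_path last_rcons => /andP[pp /exists_inP[e eG /eqP ez]] ->.
  have xl : connect (adjacent G) x (last x p) by apply/connectP; exists p.
  apply: connect_trans (IHp _ pp erefl) (connect1 _).
  apply/exists_inP; exists e; last by rewrite /= ez.
  by rewrite !inE eG /= (ends_component (y := last x p)) // ez set21.
apply/andP; split.
  by apply/set0Pn; exists x; rewrite !inE xG connect0.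
apply/forall_inP => y; rewrite !inE => /andP[_ xy].
apply/forall_inP => z; rewrite !inE => /andP[_ xz].
apply: connect_trans (xcomp _ xz).
rewrite (sym_connect_sym (@adjacent_sym _)); exact: xcomp.
Qed.

(* For Z a proper subset of the edges, a degree count at the vertices U outside
   the span of Z gives #|U| <= #|edges G :\: Z|; in the case of equality the
   vertices of U form cycle components. *)
Lemma bowtie_tight G : bowtie G -> tight G (edges G).
Proof.
case/and3P => niG nlG ncG Z /properP[sZ [e0 e0G e0Z]].
set W := edges G :\: Z; set U := verts G :\: span G Z.
have degG u : u \in U -> 2 <= degree G u ?= iff (degree G u == 2).
  rewrite inE => /andP[_ uG]; split; last exact: eq_sym.
  have := forall_inP niG u uG; have := forall_inP nlG u uG.
  by rewrite /isolated /leaf; lia.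
have starW u e : u \in U -> e \in edges G -> u \in ends G e -> e \in W.
  rewrite !inE => /andP[uZ _] -> ue; rewrite andbT; apply: contra uZ => eZ.
  by apply/bigcupP; exists e.
have wU e : e \in edges G -> e \notin W -> #|U :&: ends G e| = 0.
  move=> eG eW; apply/eqP; rewrite cards_eq0; apply/set0Pn => -[u /setIP[uU ue]].
  by rewrite (starW u) in eW.
have sum1 : \sum_(u in U) degree G u =
    \sum_(e in W) (if #|ends G e| == 1 then 2 else 1) * #|U :&: ends G e|.
  rewrite sum_degree (big_setID Z) /= big1 ?add0n // => e /setIP[eG eZ].
  by rewrite wU ?muln0 // !inE eZ.
have sW e : e \in W -> e \in edges G by case/setDP.
have leW := leqif_sum (fun e eW => edge_weight U (sW e eW)).
have leU := leqif_sum degG.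
rewrite -sum1 !sum_nat_const in leW leU.
have cardW : #|W| + #|Z| = #|edges G|.
  by rewrite addnC -(cardsID Z (edges G)) (setIidPr sZ).
have cardU : #|U| + #|span G Z| = #|verts G|.
  by rewrite addnC -(cardsID (span G Z) (verts G)) (setIidPr (span_sub_verts sZ)).
rewrite /excess spanE //; suff : #|U| < #|W| by lia.
rewrite ltnNge; apply/negP => leWU.
(* The degree sum over [U] lies between [2 * #|U|] and [2 * #|W|], so both bounds are attained:
   edges of [W] have all ends in [U], and vertices of [U] have degree 2. *)
case: leW => leW eqW; case: leU => leU eqU.
have /eqP : \sum_(u in U) degree G u = #|W| * 2 by lia.
rewrite eqW => /forall_inP WU.
have /eqP : #|U| * 2 = \sum_(u in U) degree G u by lia.
rewrite eqU => /forall_inP U2.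
have e0W : e0 \in W by rewrite !inE e0Z.
have [v ve0] : exists v, v \in ends G e0.
  by apply/set0Pn; rewrite -card_gt0; have /andP[] := ends_card e0G.
have vU := subsetP (WU _ e0W) _ ve0.
have vG : v \in verts G by case/setDP: vU.
(* No path from [v] leaves [U]: an edge at a vertex of [U] is in [W], hence has its other end in
   [U]. *)
have vconn y : connect (adjacent G) v y -> y \in U.
  case/connectP => p; elim/last_ind: p y => [|p z IHp] y /= ; first by move=> _ ->.
  rewrite rcons_path last_rcons => /andP[pp /exists_inP[e eG /eqP ez]] ->.
  have eW : e \in W by apply: (starW (last v p)); rewrite ?IHp // ez set21.
  by rewrite (subsetP (WU e eW)) // ez set22.
case/negP: (forall_inP ncG v vG); apply/andP; split; first exact: connected_component.
apply/forall_inP => y; rewrite !inE => /andP[_ vy].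
by rewrite degree_component // U2 ?vconn.
Qed.

(** A leaf or a cycle component could be removed without lowering the excess. *)
Lemma tight_bowtie G : no_isolated G -> tight G (edges G) -> bowtie G.
Proof.
move=> niG tG.
(* Deleting [F] removes all of [K] from the span, so the excess would not drop. *)
have no_exchange (F : {set E}) (K : {set V}) : F != set0 -> F \subset edges G ->
    K \subset verts G -> #|F| <= #|K| ->
    (forall x, x \in K -> star G x \subset F) -> False.
  move=> F0 sF sK leFK sKF.
  have /tG : edges G :\: F \proper edges G.
    rewrite properE subsetDl /= subsetD subxx /=.
    by case/set0Pn: F0 => e eF; apply/pred0Pn; exists e; rewrite /= eF (subsetP sF).
  have : #|span G (edges G :\: F)| <= #|verts G :\: K|.
    apply: subset_leq_card; rewrite subsetD span_sub_verts ?subsetDl //=.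
    apply/pred0P => x /=; apply/negP => /andP[/bigcupP[e /setDP[eG eF] xe] xK].
    by rewrite (subsetP (sKF x xK)) ?inE ?eG in eF.
  rewrite /excess spanE //.
  have := cardsID F (edges G); have := cardsID K (verts G).
  rewrite (setIidPr sF) (setIidPr sK); lia.
apply/and3P; split=> //; apply/forall_inP => x xG; apply/negP.
  move=> /eqP; rewrite /degree => lx.
  apply: (no_exchange (star G x) [set x]).
  - by apply/eqP => s0; rewrite s0 big_set0 in lx.
  - by apply/subsetP => e; rewrite inE => /andP[].
  - by rewrite sub1set.
  - rewrite cards1 -lx -sum1_card; apply: leq_sum => e _; by case: ifP.
  - by move=> y /set1P->.
case/andP => _ /forall_inP deg2.
(* A 2-regular graph has as many edges as vertices. *)
have cardK : #|edges (component G x)| = #|verts (component G x)|.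
  have := handshake (component G x).
  rewrite (eq_bigr (fun _ => 2)) ?sum_nat_const; first lia.
  by move=> y /deg2/eqP.
apply: (no_exchange (edges (component G x)) (verts (component G x))).
- rewrite -card_gt0 cardK card_gt0; apply/set0Pn.
  by exists x; rewrite !inE xG connect0.
- by apply/subsetP => e; rewrite !inE => /andP[/andP[]].
- exact: subsetIl.
- by rewrite cardK.
- move=> y; rewrite !inE => /andP[_ xy]; apply/subsetP => e.
  by rewrite !inE => /andP[eG ye]; rewrite eG /=; apply: ends_component ye xy.
Qed.

Lemma edges_edge_induced G X : X \subset edges G -> edges (edge_induced G X) = X.
Proof.
move=> sX; apply/setP => e; rewrite !inE; apply/andP/idP => [[/andP[]]//|eX].
by rewrite (subsetP sX) // eX (bigcup_sup e).
Qed.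

Lemma verts_edge_induced G X : X \subset edges G ->
  verts (edge_induced G X) = span G X.
Proof. by move=> sX; apply/setIidPr; apply: span_sub_verts. Qed.

Lemma no_isolated_edge_induced G X : X \subset edges G ->
  no_isolated (edge_induced G X).
Proof.
move=> sX; apply/forall_inP => x.
rewrite verts_edge_induced // => /bigcupP[e eX xe].
rewrite /isolated /degree (big_setD1 e) /=; first by case: ifP.
by rewrite inE edges_edge_induced // eX.
Qed.

Lemma circuitsP k G X : reflect
  [/\ X \subset edges G, tight G X & excess G X = k%:Z%R] (X \in circuits k G).
Proof.
rewrite inE; apply: (iffP and3P) => -[sX].
  rewrite /Delta edges_edge_induced // verts_edge_induced // => /eqP eX.
  by move/bowtie_tight; rewrite edges_edge_induced.
move=> tX eX; split=> //.
  by rewrite /Delta edges_edge_induced // verts_edge_induced //; apply/eqP.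
by apply: tight_bowtie; rewrite ?no_isolated_edge_induced ?edges_edge_induced.
Qed.

Lemma edges_del_vertex G x : edges (del_vertex G x) = edges G :\: star G x.
Proof.
apply/setP => e; rewrite !inE andbT subsetC sub1set inE.
by case: (e \in edges G); rewrite ?andbF ?andbT.
Qed.

Lemma span_del_vertex G x : no_isolated (del_vertex G x) ->
  span G (edges G :\: star G x) = verts G :\ x.
Proof.
by move=> ni; rewrite -edges_del_vertex [RHS]setDE; apply: (spanE ni).
Qed.

End Bowtie.

(** * Unions of circuits, and the excess as determined by the circuits *)

Section EqualMatroids.
Variable k : nat.
Hypothesis k_gt0 : 0 < k.

(** For positive [k] these are the nonempty unions of circuits, as the next two lemmas show; so the
    notion depends on [G] only through its circuits. *)
Definition cyclic_set (V E : finType) (G : graph V E) (X : {set E}) : Prop :=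
  [/\ X \subset edges G, tight G X & (k%:Z <= excess G X)%R].

Lemma cyclic_set_circuit (V E : finType) (G : graph V E) (X : {set E}) a :
  cyclic_set G X -> a \in X ->
  exists C, [/\ C \in circuits k G, C \subset X & a \in C].
Proof.
move=> [sX tX kX] aX.
have [n] : exists n : nat, excess G X = (k%:Z + n%:Z)%R.
  by exists `|(excess G X - k%:Z)%R|; lia.
elim: n X sX tX {kX} aX => [|n IHn] X sX tX aX eX.
  by exists X; split=> //; apply/circuitsP; split=> //; rewrite eX addr0.
have [|Y [sY aY tY eY]] := tight_subset_at_edge tX _ aX; first by lia.
have [|C [cC sC aC]] := IHn Y (subset_trans sY sX) tY aY; first by lia.
by exists C; split=> //; apply: subset_trans sY.
Qed.

(** Tightness passes to unions by [tightU], and a tight set has at least the excess [k] of any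
    circuit inside it. *)
Lemma cyclic_set_of_circuits (V E : finType) (G : graph V E) (X : {set E}) :
  X != set0 ->
  (forall a, a \in X -> exists C, [/\ C \in circuits k G, C \subset X & a \in C]) ->
  cyclic_set G X.
Proof.
move=> X0 cov; pose P := [set C in circuits k G | C \subset X].
have -> : X = \bigcup_(C in P) C.
  apply/eqP; rewrite eqEsubset; apply/andP; split; apply/subsetP => a.
    move=> /cov[C [cC sC aC]]; apply/bigcupP; exists C => //.
    by rewrite in_set cC.
  by case/bigcupP => C; rewrite in_set => /andP[_ /subsetP]; apply.
have tU : tight G (\bigcup_(C in P) C).
  apply: big_ind => [Z|A B|C].
  - by rewrite properE sub0set andbF.
  - exact: tightU.
  - by rewrite in_set => /andP[/circuitsP[]].
split=> //.
  by apply/bigcupsP => C; rewrite in_set => /andP[/circuitsP[]].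
case/set0Pn: X0 => a /cov[C [cC sC _]].
have /circuitsP[_ _ <-] := cC; apply: tight_subset => //.
by apply: bigcup_sup; rewrite in_set cC.
Qed.

Variables (V V' E : finType) (G : graph V E) (G' : graph V' E).

Lemma cyclic_set_transfer X : circuits k G = circuits k G' ->
  cyclic_set G X -> cyclic_set G' X.
Proof.
move=> eqC cX; apply: cyclic_set_of_circuits.
  apply/eqP => X0; case: cX => _ _; rewrite X0 excess0; lia.
by move=> a aX; rewrite -eqC; apply: cyclic_set_circuit.
Qed.

(** Descend in [G] through tight sets, the excess falling by 1 each time, down to [k]. The same
    chain consists of tight sets of [G'], where each proper inclusion gains at least 1, starting
    from at least [k]. *)
Lemma cyclic_set_excess_le X : circuits k G = circuits k G' ->
  cyclic_set G X -> (excess G X <= excess G' X)%R.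
Proof.
move=> eqC cX; have [n] : exists n : nat, excess G X = (k%:Z + n%:Z)%R.
  by case: cX => _ _ kX; exists `|(excess G X - k%:Z)%R|; lia.
elim: n X cX => [|n IHn] X cX eX; have [_ tX' kX'] := cyclic_set_transfer eqC cX.
  by rewrite eX addr0.
case: (cX) => sX tX kX.
have [|| Y [sY tY eY]] := @tight_subset_of_excess _ _ G X (excess G X - 1)%R;
  [lia | lia |].
have cY : cyclic_set G Y by split; [exact: subset_trans sX | | lia].
have := IHn Y cY; have : Y \proper X.
  by rewrite properEneq sY andbT; apply/eqP => eqY; rewrite eqY in eY; lia.
by move/tX'; lia.
Qed.

End EqualMatroids.

Lemma cyclic_set_excess k (V V' E : finType) (G : graph V E) (G' : graph V' E) X :
  0 < k -> circuits k G = circuits k G' -> cyclic_set k G X ->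
  excess G X = excess G' X.
Proof.
move=> k_gt0 eqC cX; apply/eqP; rewrite eq_le !(@cyclic_set_excess_le k) //.
exact: cyclic_set_transfer cX.
Qed.

(** * Recovering the stars and the isomorphism *)

Section Reconstruction.
Variables (V V' E : finType) (G : graph V E) (G' : graph V' E).

(** After deletion of [x], another vertex [y] still has an edge, and this edge is in the star of [y]
    only. *)
Lemma star_inj :
  (forall x, x \in verts G -> no_isolated (del_vertex G x)) ->
  {in verts G &, injective (star G)}.
Proof.
move=> niG x y xG yG exy; apply/eqP/negPn/negP => nxy.
have : y \in span G (edges G :\: star G x).
  by rewrite span_del_vertex ?niG // !inE eq_sym nxy.
by case/bigcupP => e; rewrite exy !inE => /andP[nye eG] ye; rewrite eG ye in nye.
Qed.

(* The complement of the star of x is a cyclic flat of the matroid, spanning all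
   vertices but one. *)
Lemma star_transfer k x : 0 < k -> edges G = edges G' ->
  circuits k G = circuits k G' -> no_isolated G' -> #|verts G| = #|verts G'| ->
  x \in verts G -> (k%:Z <= Delta (del_vertex G x))%R -> bowtie (del_vertex G x) ->
  exists2 x', x' \in verts G' & star G x = star G' x'.
Proof.
move=> k_gt0 eqE eqC niG' eqV xG kx bx.
set H := edges G :\: star G x.
have nix : no_isolated (del_vertex G x) by case/and3P: bx.
have spanH : span G H = verts G :\ x by apply: span_del_vertex.
have cH : cyclic_set k G H.
  split; first exact: subsetDl.
    by have := bowtie_tight bx; rewrite edges_del_vertex.
  by move: kx; rewrite /Delta edges_del_vertex /= -setDE -spanH.
have [sH' tH' kH'] := cyclic_set_transfer k_gt0 eqC cH.
have eqH := cyclic_set_excess k_gt0 eqC cH.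
(* Equal excess means that [H] spans equally many vertices in both graphs, namely all but one. *)
have : #|verts G' :\: span G' H| = 1.
  have := cardsID (span G' H) (verts G').
  rewrite (setIidPr (span_sub_verts sH')).
  have := cardsD1 x (verts G); rewrite xG -spanH.
  move: eqH; rewrite /excess; lia.
case/eqP/cards1P => x' ex'.
have /setDP[x'G' x'H] : x' \in verts G' :\: span G' H by rewrite ex' set11.
exists x' => //.
suff eqHH : edges G' :\: star G' x' = H.
  have sub (W : finType) (K : graph W E) z :
      star K z = edges K :\: (edges K :\: star K z).
    rewrite setDDr setDv set0U; apply/esym/setIidPr.
    by apply/subsetP => e; rewrite inE => /andP[].
  by rewrite sub -/H -eqHH [RHS]sub eqE.
apply/eqP; rewrite eqEsubset; apply/andP; split; apply/subsetP => e; last first.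
  move=> eH; rewrite !inE (subsetP sH') //= andbT; apply: contra x'H => x'e.
  by apply/bigcupP; exists e.
(* An edge [e] outside [H] and not at [x'] would add no new vertex to the span of [H] in [G']. *)
case/setDP => eG' ex; apply/negPn/negP => eH.
have se : ends G' e \subset span G' H.
  apply/subsetP => y ye; apply/negPn/negP => yH.
  have : y \in verts G' :\: span G' H.
    by rewrite inE yH (subsetP (ends_verts eG')).
  by rewrite ex' => /set1P eqy; rewrite inE eG' -eqy ye in ex.
have spanHe : span G' (e |: H) = span G' H.
  by rewrite spanU /span big_set1; apply/setUidPr.
have eHe : excess G' (e |: H) = (excess G' H + 1)%R.
  rewrite /excess spanHe cardsU1 eH; lia.
have cHe : cyclic_set k G' (e |: H).
  split; [by rewrite subUset sub1set eG' | | by lia].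
  (* If [e] is not in [Z], then [Z] lies in [H]; otherwise [Z :\ e] is proper in [H], and restoring
     [e] gains at most 1. *)
  move=> Z /properP[sZ [f feH fZ]].
  have [eZ|eZ] := boolP (e \in Z); last first.
    have : Z \subset H.
      apply/subsetP => g gZ; have := subsetP sZ g gZ; rewrite in_setU1.
      by case/predU1P => // eqg; rewrite -eqg gZ in eZ.
    by rewrite eHe ltzD1; apply: tight_subset.
  have /tH' : Z :\ e \proper H.
    apply/properP; split; first by rewrite subDset.
    exists f; last by rewrite inE negb_and fZ orbT.
    by case/setU1P: feH => // eqf; rewrite eqf eZ in fZ.
  by move=> ltZ; rewrite eHe -ltrBlDr; apply: le_lt_trans (excess_delete _ _ _) ltZ.
(* In [G] the edge [e] is at [x], so it adds the missing vertex and does not raise the excess of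
   [H], whereas in [G'] it does. *)
have := cyclic_set_excess k_gt0 (esym eqC) cHe; rewrite eHe -eqH.
have : #|verts G| <= #|span G (e |: H)|.
  apply: subset_leq_card; rewrite -(setD1K xG) -spanH spanU setSU // sub1set.
  rewrite /span big_set1; move: eH; rewrite !inE eqE eG' andbT negbK.
  by case/andP.
rewrite /excess spanH (cardsD1 x (verts G)) xG cardsU1 eH; lia.
Qed.

(** The ends of an edge are the vertices whose stars contain it. Surjectivity of [nu] ensures that
    every end in [G'] is an image. *)
Lemma strongly_isomorphic_of_stars (nu : {x | x \in verts G} -> {x | x \in verts G'}) :
  edges G = edges G' -> bijective nu ->
  (forall x, star G (val x) = star G' (val (nu x))) -> strongly_isomorphic G G'.
Proof.
move=> eqE bij_nu star_nu; split=> //; exists nu; split=> // e eG x y.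
have endsE z : (val z \in ends G e) = (val (nu z) \in ends G' e).
  by have /setP/(_ e) := star_nu z; rewrite !inE -eqE eG.
have eG' : e \in edges G' by rewrite -eqE.
have nu_inj := bij_inj bij_nu; case: bij_nu => mu _ muK.
split=> exy; apply/setP => z; apply/idP/idP.
- move=> ze; have zG' := subsetP (ends_verts eG') z ze.
  have zE : z = val (nu (mu (Sub z zG'))) by rewrite muK.
  move: ze; rewrite zE -endsE exy !inE !(inj_eq val_inj) => /orP[] /eqP->.
    by rewrite eqxx.
  by rewrite eqxx orbT.
- by rewrite !inE => /orP[] /eqP->; rewrite -endsE exy ?set21 ?set22.
- move=> ze; have zG := subsetP (ends_verts eG) z ze.
  have zE : z = val (Sub z zG : {x | x \in verts G}) by [].
  by move: ze; rewrite zE endsE exy !inE !(inj_eq val_inj) !(inj_eq nu_inj).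
- by rewrite !inE => /orP[] /eqP->; rewrite endsE exy ?set21 ?set22.
Qed.

End Reconstruction.

Theorem theorem5p6 (V V' E : finType) (G : graph V E) (G' : graph V' E)
    (k : nat) (k_ge2 : 2 <= k)
    (G'_no_isolated : no_isolated G')
    (a1 : (k%:Z <= Delta G)%R /\ bowtie G)
    (a2 : forall x : V, x \in verts G ->
            (k%:Z <= Delta (del_vertex G x))%R /\ bowtie (del_vertex G x))
    (a3 : circular_matroid k G' = circular_matroid k G) :
  stars G = stars G' /\ strongly_isomorphic G G'.
Proof.
have k_gt0 : 0 < k by apply: ltnW.
case: a3 => /esym eqE /esym eqC; case: a1 => kG bG.
have spanG : span G (edges G) = verts G by apply: spanE; case/and3P: bG.
have cG : cyclic_set k G (edges G).
  by split; [| exact: bowtie_tight | rewrite /excess spanG].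
(* The full edge set has the same excess in both graphs and spans all vertices of each. *)
have eqV : #|verts G| = #|verts G'|.
  have := cyclic_set_excess k_gt0 eqC cG.
  by rewrite /excess spanG [in span G' _]eqE (spanE G'_no_isolated); lia.
have nu_ex (x : {x | x \in verts G}) :
    exists x' : {x' | x' \in verts G'}, star G (val x) == star G' (val x').
  case: x => x xG; case: (a2 x xG) => kx bx.
  have [x' x'G' sx] := star_transfer k_gt0 eqE eqC G'_no_isolated eqV xG kx bx.
  by exists (exist _ x' x'G'); apply/eqP.
pose nu x := xchoose (nu_ex x).
have star_nu x : star G (val x) = star G' (val (nu x)).
  exact/eqP/(xchooseP (nu_ex x)).
have nu_inj : injective nu.
  move=> x y exy; apply/val_inj/(@star_inj _ _ G); rewrite ?(valP x) ?(valP y) //.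
    by move=> z /a2[_ /and3P[]].
  by rewrite !star_nu exy.
have nu_bij : bijective nu.
  by apply: inj_card_bij nu_inj _; rewrite !card_sig !cardE -!cardE eqV.
split; last exact: strongly_isomorphic_of_stars nu_bij star_nu.
apply/setP => S; apply/imsetP/imsetP => -[x xG ->].
  by exists (val (nu (exist _ x xG))); [exact: valP | rewrite -star_nu].
case: nu_bij => mu _ muK; pose x' := exist (fun x => x \in verts G') x xG.
by exists (val (mu x')); [exact: valP | rewrite star_nu muK].
Qed.
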